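(* If $g_i(p)=\min(\alpha_i p,1)$, $i=1,2$, for $1<\alpha_1<\alpha_2$, then deductible insurance is optimal.
   Context: Let $(\Omega,\mathcal{F},\mathbb{P})$ be a probability space. For an almost surely finite random variable $Y$ let $S_Y(t)=\mathbb{P}(Y>t)$. A concave distortion is a non-decreasing concave function $g:[0,1]\to[0,1]$ with $g(0)=0$, $g(1)=1$; its distortion risk measure is $H_g(Y)=\int_{-\infty}^0(g[S_Y(t)]-1)\,dt+\int_0^\infty g[S_Y(t)]\,dt$. An individual (agent 2) faces a random loss $X\ge 0$ and may buy insurance from an insurer (agent 1, with initial loss $0$). The distortions of insurer and buyer are $g_1$ and $g_2$; $H_{g_2}(X)$ is assumed finite. There are constants $0<b_1<\theta$. The preference functionals (to be minimized) are $$V_1(Y)=(1+b_1)H_{g_1}(Y)-(1+\theta)\,\mathbb{E}Y,\qquad V_2(Y)=H_{g_2}(Y)-(1+\theta)\,\mathbb{E}Y.$$ An allocation is a pair $(Y_1,Y_2)$ with $Y_1+Y_2=X$ and $V_1(Y_1),V_2(Y_2)$ finite. It is Pareto optimal if any allocation $(Z_1,Z_2)$ with $V_i(Z_i)\le V_i(Y_i)$, $i=1,2$, satisfies $V_i(Z_i)=V_i(Y_i)$, $i=1,2$. ''Deductible insurance is optimal'' means: there is a deductible $d\in[0,\infty]$ such that, with $f^*(x)=(x-d)_+$ (and $f^*\equiv 0$ when $d=\infty$), the allocation $(f^*(X),X-f^*(X))$ is Pareto optimal. *)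

(* Defs.v *)
From HB Require Import structures.
From mathcomp Require Import all_boot all_order all_algebra.
From mathcomp Require Import all_classical all_reals all_analysis.
From mathcomp Require Import measurable_realfun.
From mathcomp Require Import lra.

Set Implicit Arguments.
Unset Strict Implicit.
Unset Printing Implicit Defensive.

Import Order.TTheory GRing.Theory Num.Theory.
Import numFieldNormedType.Exports.

Local Open Scope classical_set_scope.
Local Open Scope ring_scope.

(* A distortion g : [0,1] -> [0,1] is represented by a function on R of which
   only the restriction to [0,1] matters. *)
Definition concave_distortion (R : realType) (g : R -> R) : Prop :=
  [/\ {in `[0, 1], forall p, g p \in `[0, 1]},
      g 0 = 0 /\ g 1 = 1,
      {in `[0, 1] &, {homo g : p q / p <= q}} &
      convex_function (`[0, 1] : set R) (fun p => - g p : R^o)].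

Lemma concave_distortion_min (R : realType) (alpha : R) :
  1 < alpha -> concave_distortion (fun p => Num.min (alpha * p) 1).
Proof.
move=> a1; split.
- move=> p; rewrite !in_itv/= => /andP[p0 p1].
  by rewrite ge_min lexx orbT andbT le_min ler01 andbT mulr_ge0//; lra.
- by split; [rewrite mulr0 min_l | rewrite mulr1 min_r// ltW].
- move=> p q _ _ pq; rewrite le_min !ge_min lexx orbT andbT.
  by rewrite ler_wpM2l//; lra.
- move=> t x y _ _; rewrite !convRE.
  have t0 : 0 <= t%:num by [].
  have t1 : t%:num <= 1 by [].
  have t1' : 0 <= 1 - t%:num by rewrite subr_ge0.
  rewrite !mulrN -opprD lerN2 le_min.
  have mx z : Num.min (alpha * z) 1 <= alpha * z by rewrite ge_min lexx.
  have m1 z : Num.min (alpha * z) 1 <= 1 by rewrite ge_min lexx orbT.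
  apply/andP; split.
    rewrite mulrDr; apply: lerD.
      by rewrite mulrCA ler_wpM2l.
    by rewrite mulrCA ler_wpM2l.
  rewrite -[leRHS](subrK t%:num) addrC.
  by apply: lerD; rewrite ler_piMr.
Qed.

Section risk.
Context d (T : measurableType d) (R : realType) (P : probability T R).
Local Open Scope ereal_scope.
Local Notation mu := (@lebesgue_measure R).

Definition distortion_risk (g : R -> R) (Y : {RV P >-> R}) : \bar R :=
  \int[mu]_(t in `]-oo, 0%R[) (g (fine (ccdf Y t)) - 1)%:E +
  \int[mu]_(t in `[0%R, +oo[) (g (fine (ccdf Y t)))%:E.

(* In these extended-real formulas the undefined form +oo - oo takes the value
   -oo, so each functional is a fin_num exactly when all the integrals it is
   made of are well defined and finite. *)
Definition insurer_pref (g1 : R -> R) (b1 theta : R) (Y : {RV P >-> R}) :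
    \bar R :=
  (1 + b1)%:E * distortion_risk g1 Y - (1 + theta)%:E * 'E_P[Y].

Definition buyer_pref (g2 : R -> R) (theta : R) (Y : {RV P >-> R}) : \bar R :=
  distortion_risk g2 Y - (1 + theta)%:E * 'E_P[Y].

(* Random variables are identified up to almost sure equality, which is why
   real-valued representatives suffice for almost surely finite ones. *)
Definition allocation (V1 V2 : {RV P >-> R} -> \bar R)
    (X Y1 Y2 : {RV P >-> R}) : Prop :=
  [/\ {ae P, forall w, (Y1 w + Y2 w)%R = X w},
      V1 Y1 \is a fin_num & V2 Y2 \is a fin_num].

Definition pareto_optimal (V1 V2 : {RV P >-> R} -> \bar R)
    (X Y1 Y2 : {RV P >-> R}) : Prop :=
  allocation V1 V2 X Y1 Y2 /\
  forall Z1 Z2 : {RV P >-> R}, allocation V1 V2 X Z1 Z2 ->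
    V1 Z1 <= V1 Y1 -> V2 Z2 <= V2 Y2 -> V1 Z1 = V1 Y1 /\ V2 Z2 = V2 Y2.

End risk.

(* The insurer's share; the value at c = -oo is irrelevant. *)
Definition deductible (R : realType) (c : \bar R) (x : R) : R :=
  if c is r%:E then Num.max (x - r) 0 else 0.

Lemma measurable_deductible (R : realType) (c : \bar R) :
  measurable_fun [set: R] (deductible c).
Proof.
case: c => [r| |]; rewrite /deductible; [|exact: measurable_cst..].
apply: measurable_maxr; last exact: measurable_cst.
by apply: measurable_funB => //; exact: measurable_cst.
Qed.

HB.instance Definition _ (R : realType) (c : \bar R) :=
  isMeasurableFun.Build _ _ _ _ (@deductible R c) (measurable_deductible c).

Definition deductible_optimal d (T : measurableType d) (R : realType)
    (P : probability T R) (V1 V2 : {RV P >-> R} -> \bar R)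
    (X : {RV P >-> R}) : Prop :=
  exists2 c : \bar R, (0 <= c)%E &
    let f : {RV P >-> R} := deductible c \o X in
    pareto_optimal V1 V2 X f (X \- f).

(* Main.v *)
Require Import Defs.
From HB Require Import structures.
From mathcomp Require Import all_boot all_order all_algebra.
From mathcomp Require Import all_classical all_reals all_analysis.
From mathcomp Require Import measurable_realfun.
From mathcomp Require Import lra.

Set Implicit Arguments.
Unset Strict Implicit.
Unset Printing Implicit Defensive.

Import Order.TTheory GRing.Theory Num.Theory.
Import numFieldNormedType.Exports.

Local Open Scope classical_set_scope.
Local Open Scope ring_scope.

(** The two distortion risk measures are tail value-at-risks, and the proof
rests on their variational form: for g(p) = min(alpha p, 1) with alpha > 1,
<<
  H_g(Y) = min over c of c + alpha E(Y - c)_+ ,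
>>
the minimum being attained at a (1/alpha)-quantile of the upper tail of Y
([distortion_risk_le], [distortion_risk_tail_quantile]).  This follows from
E(Y - c)_+ = int_c^oo P(Y > t) dt and from moving the cut of the integral that
defines H_g from 0 to c.

Moving a constant amount of loss from insurer to buyer adds a multiple of
theta - b1 to V_1 and subtracts the same multiple of theta from V_2.  Hence the only weighted sum of
the preferences that can be bounded below is theta V_1 + (theta - b1) V_2, up to
a factor, and an allocation minimizing it is Pareto optimal
([weighted_sum_pareto]).  Put
<<
  gamma = (theta (1 + b1) alpha1 - (1 + theta) b1) / (theta - b1) > 1 .
>>
For any allocation (Z_1, Z_2), write H_(g_i)(Z_i) = c_i + alpha_i E(Z_i - c_i)_+
with optimal c_i.  Since E Z_1 <= c_1 + E(Z_1 - c_1)_+, the weighted sum is, up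
to the constant - (theta - b1) (1 + theta) E X, at least theta - b1 times
<<
  c_1 + gamma E(Z_1 - c_1)_+  +  c_2 + alpha2 E(Z_2 - c_2)_+ ,
>>
and by subadditivity of the positive part this is at least
c + min(gamma, alpha2) E(X - c)_+ at c = c_1 + c_2 ([weighted_pref_ge]).

The weighted sum of a suitable deductible is below this bound for every c at
once.  If gamma <= alpha2, take for the deductible the (1/gamma)-quantile d of
the upper tail of X, which minimizes c + gamma E(X - c)_+: the insurer pays
(X - d)_+, of risk at most alpha1 E(X - d)_+, and the buyer keeps min(X, d), of
risk at most d ([quantile_deductible_pareto]).  If alpha2 <= gamma, the buyer
keeps everything and H_(g_2)(X) <= c + alpha2 E(X - c)_+ gives the bound
([full_retention_pareto]). *)

(** * Integrals over half-lines and expected excesses *)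

Lemma ge0_integral_itv_split (R : realType) (f : R -> R)
    (a b c : itv_bound R) :
  measurable_fun [set: R] f -> (forall t, 0 <= f t) ->
  (a <= b)%O -> (b <= c)%O ->
  (\int[@lebesgue_measure R]_(t in [set` Interval a c]) (f t)%:E =
   \int[@lebesgue_measure R]_(t in [set` Interval a b]) (f t)%:E +
   \int[@lebesgue_measure R]_(t in [set` Interval b c]) (f t)%:E)%E.
Proof.
move=> mf f0 ab bc; rewrite (itv_bndbnd_setU ab bc) ge0_integral_setU//=.
- by apply/measurable_EFinP; exact: measurable_funTS.
- by move=> t _; rewrite lee_fin.
- apply/disj_setPS => t [/=]; rewrite !itv_boundlr => /andP[_ tb] /andP[bt _].
  by have := le_trans tb bt; rewrite bnd_simp ltxx.
Qed.

(** The point at which the integral defining a distortion risk measure is cut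
into a part over [u - 1] and a part over [u] can be moved from 0 to any [c]:
over the stretch in between the two integrands differ by 1, which the summand
[c] compensates. *)
Lemma integral_split_shift (R : realType) (u : R -> R) (c : R) :
  measurable_fun [set: R] u -> (forall t, 0 <= u t <= 1) ->
  (\int[@lebesgue_measure R]_(t in `]-oo, 0%R[) (u t - 1)%:E +
   \int[@lebesgue_measure R]_(t in `[0%R, +oo[) (u t)%:E =
   c%:E + \int[@lebesgue_measure R]_(t in `]-oo, c[) (u t - 1)%:E +
   \int[@lebesgue_measure R]_(t in `[c, +oo[) (u t)%:E)%E.
Proof.
move=> mu_u u01; set mu := @lebesgue_measure R.
have u0 t : 0 <= u t by case/andP: (u01 t).
have v0 t : 0 <= 1 - u t by rewrite subr_ge0; case/andP: (u01 t).
have mv : measurable_fun [set: R] (fun t => 1 - u t) by exact: measurable_funB.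
have N D : (\int[mu]_(t in D) (u t - 1)%:E =
    - \int[mu]_(t in D) (1 - u t)%:E)%E.
  rewrite -integral_ge0N; last by move=> t _; rewrite lee_fin.
  by apply: eq_integral => t _; rewrite -EFinN opprB.
rewrite !N.
suff shift a b : a <= b ->
    (a%:E - \int[mu]_(t in `]-oo, a[) (1 - u t)%:E +
     \int[mu]_(t in `[a, +oo[) (u t)%:E =
     b%:E - \int[mu]_(t in `]-oo, b[) (1 - u t)%:E +
     \int[mu]_(t in `[b, +oo[) (u t)%:E)%E.
  rewrite -[X in (X + _ = _)%E]add0e.
  by case: (leP 0 c) => [/shift|/ltW /shift /esym].
move=> ab.
rewrite (@ge0_integral_itv_split _ u (BLeft a) (BLeft b) +oo%O)//.
rewrite (@ge0_integral_itv_split _ (fun t => 1 - u t)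
  -oo%O (BLeft a) (BLeft b))//.
have ge0I D (f : R -> R) : (forall t, 0 <= f t) ->
    (0 <= \int[mu]_(t in D) (f t)%:E)%E.
  by move=> f0; apply: integral_ge0 => t _; rewrite lee_fin.
(* The length of [a, b[ is what keeps both of its integrals finite. *)
have sum_ab : (\int[mu]_(t in `[a, b[) (u t)%:E +
    \int[mu]_(t in `[a, b[) (1 - u t)%:E = (b - a)%:E)%E.
  rewrite -ge0_integralD//=; last 4 first.
  - by move=> t _; rewrite lee_fin.
  - by apply/measurable_EFinP; exact: measurable_funTS.
  - by move=> t _; rewrite lee_fin.
  - by apply/measurable_EFinP; exact: measurable_funTS.
  under eq_integral do rewrite -EFinD addrCA subrr addr0.
  rewrite integral_cst//= mul1e /mu lebesgue_measure_itv/= lte_fin EFinB.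
  by case: ltgtP ab => // -> _; rewrite subee.
have alg (A B I J : \bar R) : (0 <= I)%E -> (0 <= J)%E ->
    (I + J = (b - a)%:E)%E ->
    (a%:E - A + (I + B) = b%:E - (A + J) + B)%E.
  case: I J => [r| |]// [s| |]// _ _ [rs].
  rewrite fin_num_oppeD//.
  case: A B => [x| |] [y| |]//=.
  by congr EFin; lra.
by apply: alg; rewrite ?ge0I.
Qed.

(** Tonelli for the indicator of c <= t < Y w: integrating it over t first gives
the length of [c, Y w[, which is the excess of Y over c. *)
Lemma expectation_excess d (T : measurableType d) (R : realType)
    (P : probability T R) (Y : {RV P >-> R}) (c : R) :
  ('E_P[deductible c%:E \o Y] =
   \int[@lebesgue_measure R]_(t in `[c, +oo[) ccdf Y t)%E.
Proof.
pose A : set (T * measurableTypeR R) := [set z | c <= z.2 < Y z.1].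
have mA : measurable A.
  rewrite -[A]setTI; apply: (_ : measurable_fun setT
    (fun z : T * measurableTypeR R => c <= z.2 < Y z.1)) => //.
  apply: measurable_and.
    by apply: measurable_fun_ler => //; exact: measurable_snd.
  by apply: measurable_fun_ltr; [exact: measurable_snd|exact: measurableT_comp].
pose f z : \bar R := (\1_A z)%:E.
have mf : measurable_fun setT f.
  by apply/measurable_EFinP; exact: measurable_indic.
have f0 z : (0 <= f z)%E by rewrite lee_fin.
have fE w t : f (w, t) = ((c <= t < Y w)%R : nat)%:R%:E.
  rewrite /f indicE; case: (boolP (c <= t < Y w)) => h.
    by rewrite mem_set.
  by rewrite memNset//; exact/negP.
transitivity (\int[P]_w \int[@lebesgue_measure R]_t f (w, t))%E.
  rewrite unlock; apply: eq_integral => w _.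
  transitivity (\int[@lebesgue_measure R]_t (\1_(`[c, Y w[ : set R) t)%:E)%E.
    rewrite integral_indic//= setIT lebesgue_measure_itv/= lte_fin -EFinB.
    case: ltP => [/ltW|] cY; first by rewrite max_l// subr_ge0.
    by rewrite max_r// subr_le0.
  by apply: eq_integral => t _; rewrite fE indicE mem_setE in_itv.
rewrite (@fubini_tonelli _ _ _ _ _ P (@lebesgue_measure R) f mf)//.
rewrite [RHS]integral_mkcond.
apply: eq_integral => t _; rewrite patchE mem_setE in_itv/= andbT.
under eq_integral do rewrite fE.
case: leP => [ct|tc]; last first.
  by under eq_integral do rewrite andFb; rewrite integral0.
under eq_integral do rewrite andTb.
transitivity (\int[P]_w (\1_(Y @^-1` `]t, +oo[) w)%:E)%E.
  apply: eq_integral => w _; rewrite indicE.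
  by case: ltP => tY; [rewrite mem_set|rewrite memNset];
    rewrite //= in_itv/= andbT ?tY// ltNge tY.
rewrite integral_indic ?setIT// -[X in measurable X]setTI.
exact: measurable_funPT.
Qed.

(** * Survival functions and quantiles *)

Section survival.
Context d (T : measurableType d) (R : realType) (P : probability T R).
Implicit Type Y : {RV P >-> R}.

Lemma fine_ccdfK Y t : (fine (ccdf Y t))%:E = ccdf Y t.
Proof. by rewrite fineK// fin_num_measure. Qed.

Lemma fine_ccdf_itv Y t : fine (ccdf Y t) \in `[0, 1].
Proof.
by rewrite in_itv/= -!lee_fin fine_ccdfK measure_ge0 probability_le1.
Qed.

Lemma fine_ccdf_ge0 Y t : 0 <= fine (ccdf Y t).
Proof. by rewrite (itvP (fine_ccdf_itv Y t)). Qed.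

Lemma fine_ccdf_le1 Y t : fine (ccdf Y t) <= 1.
Proof. by rewrite (itvP (fine_ccdf_itv Y t)). Qed.

Lemma fine_ccdf_nonincreasing Y : nonincreasing_fun (fun t => fine (ccdf Y t)).
Proof. by move=> s t st; rewrite -lee_fin !fine_ccdfK ccdf_nonincreasing. Qed.

(** This says P(Y > q) <= p <= P(Y >= q); by monotonicity of the survival
function the lower bound can be asked at the points t < q, which is the form
that integrals over half-lines use. *)
Definition is_tail_quantile Y (p q : R) : Prop :=
  (forall t, t < q -> p <= fine (ccdf Y t)) /\
  (forall t, q <= t -> fine (ccdf Y t) <= p).

(** The quantile is the infimum of the points where the survival function is at
most [p]; that set is nonempty and bounded below because the survival function
tends to 0 and 1 at the two ends, and contains its infimum by right
continuity. *)
Lemma tail_quantile_exists Y (p : R) : 0 < p < 1 ->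
  exists q, is_tail_quantile Y p q.
Proof.
move=> /andP[p0 p1]; set S := fun t => fine (ccdf Y t).
pose A := [set t | S t <= p].
have [a Sa] : exists a, S a <= p.
  apply: contrapT => /forallNP Sp.
  have : (p%:E <= lim (ccdf Y @ +oo%R))%E.
    apply: lime_ge; first by apply/cvg_ex; exists 0%E; exact: cvg_ccdfy0.
    apply: nearW => t; rewrite -fine_ccdfK lee_fin ltW// ltNge.
    exact/negP/Sp.
  by rewrite (cvg_lim _ (cvg_ccdfy0 Y))// lee_fin leNgt p0.
have [b Sb] : exists b, p < S b.
  apply: contrapT => /forallNP Sp.
  have : (lim (ccdf Y @ -oo%R) <= p%:E)%E.
    apply: lime_le; first by apply/cvg_ex; exists 1%E; exact: cvg_ccdfNy1.
    apply: nearW => t; rewrite -fine_ccdfK lee_fin leNgt.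
    exact/negP/Sp.
  by rewrite (cvg_lim _ (cvg_ccdfNy1 Y))// lee_fin leNgt p1.
have Ainf : has_inf A.
  split; first by exists a.
  exists b => t At; rewrite leNgt; apply/negP => tb.
  have := fine_ccdf_nonincreasing Y (ltW tb); rewrite leNgt.
  by rewrite (le_lt_trans At Sb).
exists (inf A); split => [t tA|t].
  rewrite leNgt; apply/negP => Stp; move: tA; rewrite ltNge => /negP; apply.
  by apply: ge_inf; [case: Ainf|exact: ltW].
have SltA s : inf A < s -> S s <= p.
  move=> /(inf_lt Ainf.1)[r Ar rs].
  by rewrite (le_trans _ Ar)// fine_ccdf_nonincreasing// ltW.
rewrite le_eqVlt => /predU1P[<-|]; last exact: SltA.
rewrite -lee_fin fine_ccdfK.
have /cvgP cS := @ccdf_right_continuous _ _ _ _ Y (inf A).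
rewrite -(cvg_lim _ (@ccdf_right_continuous _ _ _ _ Y (inf A)))//.
apply: lime_le => //.
near=> s; rewrite -fine_ccdfK lee_fin; apply: SltA.
by near: s; exact: nbhs_right_gt.
Unshelve. all: by end_near.
Qed.

(** The survival function of a nonnegative variable is 1 at negative points, so
it cannot be at most [p] there.  This makes a quantile a legitimate
deductible. *)
Lemma tail_quantile_ge0 Y (p q : R) : p < 1 -> is_tail_quantile Y p q ->
  {ae P, forall w, 0 <= Y w} -> 0 <= q.
Proof.
move=> p1 [_ Sp] Y0; rewrite leNgt; apply/negP => q0.
have : (ccdf Y (q / 2) <= p%:E)%E by rewrite -fine_ccdfK lee_fin Sp//; lra.
apply/negP; rewrite -ltNge; suff -> : ccdf Y (q / 2) = 1%E by rewrite lte_fin.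
rewrite ccdf_1_cdf [cdf Y _](_ : _ = 0%E) ?sube0//.
apply: (@measure_negligible _ _ _ P (Y @^-1` `]-oo, q / 2])).
  by rewrite -[X in measurable X]setTI; exact: measurable_funPT.
case: Y0 => N [mN N0 sN]; exists N; split => // w /=; rewrite in_itv/= => Yq.
by apply: sN => /=; apply/negP; rewrite -ltNge; lra.
Qed.

End survival.

(** * Finite expectations and excesses *)

Section expectations.
Context d (T : measurableType d) (R : realType) (P : probability T R).
Implicit Type Y : {RV P >-> R}.

Lemma expectation_fin_numP Y :
  ('E_P[Y])%E \is a fin_num <-> P.-integrable setT (EFin \o Y).
Proof.
rewrite !expectation.unlock; split; last exact: integrable_fin_num.
rewrite -integral_fin_num_abs// => Yfin; apply/integrableP; split => //.
exact/measurable_EFinP.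
Qed.

Lemma ae_expectationD (X Y1 Y2 : {RV P >-> R}) :
  {ae P, forall w, (Y1 w + Y2 w)%R = X w} ->
  ('E_P[Y1])%E \is a fin_num -> ('E_P[Y2])%E \is a fin_num ->
  ('E_P[X] = 'E_P[Y1] + 'E_P[Y2])%E.
Proof.
move=> sumX /expectation_fin_numP i1 /expectation_fin_numP i2.
rewrite !expectation.unlock -integralD_EFin//; apply: ae_eq_integral => //.
- exact/measurable_EFinP.
- by apply/measurable_EFinP; exact: measurable_funD.
- by apply: filterS sumX => w /= <- _.
Qed.

Lemma excess_fin_num Y (c : R) : ('E_P[Y])%E \is a fin_num ->
  ('E_P[deductible c%:E \o Y])%E \is a fin_num.
Proof.
move=> /expectation_fin_numP iY; apply/expectation_fin_numP.
have ic := finite_measure_integrable_cst P c measurableT.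
have iYc : P.-integrable setT (EFin \o (fun w => Y w - c)).
  exact: (integrableB _ iY ic).
apply: le_integrable iYc => //; first exact/measurable_EFinP.
move=> w _; rewrite lee_fin /deductible/=; case: (leP (Y w - c) 0) => // _.
by rewrite normr0.
Qed.

Lemma excess_ge Y (c : R) : ('E_P[Y])%E \is a fin_num ->
  ('E_P[Y] - c%:E <= 'E_P[deductible c%:E \o Y])%E.
Proof.
move=> fY; have /expectation_fin_numP ie := excess_fin_num c fY.
have /expectation_fin_numP iY := fY.
have ic := finite_measure_integrable_cst P c measurableT.
rewrite [X in (_ - X <= _)%E](_ : _ = 'E_P[cst c])%E;
  last by rewrite expectation_cst.
rewrite !expectation.unlock -integralB_EFin//.
apply: le_integral => //; first exact: (integrableB _ iY ic).
by move=> w _; rewrite /= lee_fin le_max lexx.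
Qed.

(** Pointwise, (x + y - c1 - c2)_+ <= (x - c1)_+ + (y - c2)_+. *)
Lemma excess_subadditive (X Y1 Y2 : {RV P >-> R}) (c1 c2 : R) :
  {ae P, forall w, (Y1 w + Y2 w)%R = X w} ->
  ('E_P[deductible (c1 + c2)%:E \o X] <=
   'E_P[deductible c1%:E \o Y1] + 'E_P[deductible c2%:E \o Y2])%E.
Proof.
move=> sumX.
rewrite !expectation.unlock -ge0_integralD//=; last 4 first.
- by move=> w _; rewrite lee_fin le_max lexx orbT.
- by apply/measurable_EFinP; exact: (measurable_funPT (deductible c1%:E \o Y1)).
- by move=> w _; rewrite lee_fin le_max lexx orbT.
- by apply/measurable_EFinP; exact: (measurable_funPT (deductible c2%:E \o Y2)).
apply: ae_ge0_le_integral => //.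
- by move=> w _; rewrite lee_fin le_max lexx orbT.
- apply/measurable_EFinP.
  exact: (measurable_funPT (deductible (c1 + c2)%:E \o X)).
- by move=> w _; rewrite -EFinD lee_fin addr_ge0// le_max lexx orbT.
- by apply: emeasurable_funD; apply/measurable_EFinP;
    [exact: (measurable_funPT (deductible c1%:E \o Y1))|
     exact: (measurable_funPT (deductible c2%:E \o Y2))].
- apply: filterS sumX => w <- _; rewrite -EFinD lee_fin ge_max.
  have := le_max (Y1 w - c1) (Y1 w - c1) 0; have := le_max 0 (Y1 w - c1) 0.
  have := le_max (Y2 w - c2) (Y2 w - c2) 0; have := le_max 0 (Y2 w - c2) 0.
  by rewrite !lexx orbT /= => ? ? ? ?; lra.
Qed.

End expectations.

(** * The variational formula for the tail value-at-risk *)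

Section tail_risk.
Context d (T : measurableType d) (R : realType) (P : probability T R).
Variables (g : R -> R) (alpha : R).
Hypotheses (alpha_gt0 : 0 < alpha)
  (gE : {in `[0, 1], forall p, g p = Num.min (alpha * p) 1}).
Implicit Type Y : {RV P >-> R}.
Local Notation mu := (@lebesgue_measure R).

Let u Y t := Num.min (alpha * fine (ccdf Y t)) 1.

Let u01 Y t : 0 <= u Y t <= 1.
Proof.
rewrite /u le_min ler01 andbT ge_min lexx orbT andbT.
by rewrite mulr_ge0 ?(ltW alpha_gt0) ?fine_ccdf_ge0.
Qed.

Let mu_u Y : measurable_fun [set: R] (u Y).
Proof.
apply: nonincreasing_measurable => // s t st.
by rewrite /u le_min !ge_min lexx orbT andbT ler_pM2l// fine_ccdf_nonincreasing.
Qed.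

Let distortion_risk_split Y c : (distortion_risk g Y =
  c%:E + \int[mu]_(t in `]-oo, c[) (u Y t - 1)%:E +
  \int[mu]_(t in `[c, +oo[) (u Y t)%:E)%E.
Proof.
rewrite -integral_split_shift//; congr (_ + _)%E;
  by apply: eq_integral => t _; rewrite gE// fine_ccdf_itv.
Qed.

Let integral_linear Y c :
  (\int[mu]_(t in `[c, +oo[) (alpha * fine (ccdf Y t))%:E =
  alpha%:E * 'E_P[deductible c%:E \o Y])%E.
Proof.
rewrite expectation_excess -ge0_integralZl_EFin ?ltW//.
- by apply: eq_integral => t _; rewrite EFinM fine_ccdfK.
- by apply: measurable_funTS; exact: ccdf_measurable.
Qed.

(** With the integral cut at [c], the part below [c] is nonpositive, and above
[c] the bound g(p) <= alpha p gives alpha times the expected excess. *)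
Lemma distortion_risk_le Y c :
  (distortion_risk g Y <= c%:E + alpha%:E * 'E_P[deductible c%:E \o Y])%E.
Proof.
rewrite (distortion_risk_split Y c) -integral_linear; apply: leeD.
  rewrite -[leRHS]adde0 leeD2l//.
  under eq_integral do rewrite -opprB EFinN.
  have v0 t : (0 <= (1 - u Y t)%:E)%E.
    by rewrite lee_fin subr_ge0; case/andP: (u01 Y t).
  by rewrite integral_ge0N// oppe_le0 integral_ge0.
apply: ge0_le_integral => //.
- by move=> t _; rewrite lee_fin; case/andP: (u01 Y t).
- by apply/measurable_EFinP; exact: measurable_funTS (mu_u Y).
- apply/measurable_EFinP; apply: measurable_funTS; apply: measurable_funM => //.
  by apply: nonincreasing_measurable => //; exact: fine_ccdf_nonincreasing.
- by move=> t _; rewrite lee_fin /u ge_min lexx.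
Qed.

(** At the quantile both estimates of [distortion_risk_le] are equalities: below
it g is saturated at 1, above it g is linear. *)
Lemma distortion_risk_tail_quantile Y q : is_tail_quantile Y alpha^-1 q ->
  distortion_risk g Y = (q%:E + alpha%:E * 'E_P[deductible q%:E \o Y])%E.
Proof.
move=> [Sge Sle].
rewrite (distortion_risk_split Y q) -integral_linear integral0_eq ?adde0.
  congr (_ + _)%E; apply: eq_integral => t; rewrite inE/= in_itv/= andbT => qt.
  by rewrite /u min_l// mulrC -ler_pdivlMr// div1r Sle.
move=> t /=; rewrite in_itv/= => tq.
by rewrite /u min_r ?subrr// mulrC -ler_pdivrMr// div1r Sge.
Qed.

(** Since p <= g(p), a finite distortion risk forces the positive part to be
integrable; this is how the integrability of the loss is obtained. *)
Lemma distortion_risk_fin_excess Y : 1 <= alpha ->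
  distortion_risk g Y \is a fin_num ->
  ('E_P[deductible 0%:E \o Y])%E \is a fin_num.
Proof.
move=> a1; rewrite (distortion_risk_split Y 0) fin_numD => /andP[_ fin].
rewrite expectation_excess ge0_fin_numE; last exact: integral_ge0.
apply: le_lt_trans (_ : \int[mu]_(t in `[0%R, +oo[) (u Y t)%:E < +oo)%E.
  apply: ge0_le_integral => //.
  - by apply: measurable_funTS; exact: ccdf_measurable.
  - by apply/measurable_EFinP; exact: measurable_funTS (mu_u Y).
  - move=> t _; rewrite -fine_ccdfK lee_fin /u le_min fine_ccdf_le1 andbT.
    by rewrite ler_peMl ?fine_ccdf_ge0.
by rewrite ltey_eq fin.
Qed.

End tail_risk.

(** Both sides are compared with the tail value-at-risk of Y at level
[alpha]. *)
Lemma tail_quantile_minimizes d (T : measurableType d) (R : realType)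
    (P : probability T R) (Y : {RV P >-> R}) (alpha q c : R) :
  0 < alpha -> is_tail_quantile Y alpha^-1 q ->
  (q%:E + alpha%:E * 'E_P[deductible q%:E \o Y] <=
   c%:E + alpha%:E * 'E_P[deductible c%:E \o Y])%E.
Proof.
move=> alpha_gt0 tq; pose g p := Num.min (alpha * p) 1.
have gE : {in `[0, 1], forall p, g p = Num.min (alpha * p) 1} by [].
rewrite -(distortion_risk_tail_quantile alpha_gt0 gE tq).
exact: distortion_risk_le alpha_gt0 gE Y c.
Qed.

(** For integrable Y the variational formula holds between real numbers, and in
particular the risk is finite. *)
Lemma distortion_risk_attained d (T : measurableType d) (R : realType)
    (P : probability T R) (alpha : R) (g : R -> R)
    (Y : {RV P >-> R}) :
  1 < alpha -> {in `[0, 1], forall p, g p = Num.min (alpha * p) 1} ->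
  ('E_P[Y])%E \is a fin_num ->
  exists q, [/\ distortion_risk g Y \is a fin_num,
    ('E_P[deductible q%:E \o Y])%E \is a fin_num &
    fine (distortion_risk g Y) =
      q + alpha * fine ('E_P[deductible q%:E \o Y])%E].
Proof.
move=> a1 gE EY; have a0 : 0 < alpha by lra.
have [|q tq] := @tail_quantile_exists _ _ _ P Y alpha^-1.
  by rewrite invr_gt0 a0/= invf_lt1.
have Eq := excess_fin_num q EY.
exists q; rewrite (distortion_risk_tail_quantile a0 gE tq).
by rewrite -(fineK Eq).
Qed.

Lemma fine_distortion_risk_le d (T : measurableType d) (R : realType)
    (P : probability T R) (alpha : R) (g : R -> R)
    (Y : {RV P >-> R}) (c : R) :
  1 < alpha -> {in `[0, 1], forall p, g p = Num.min (alpha * p) 1} ->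
  ('E_P[Y])%E \is a fin_num ->
  fine (distortion_risk g Y) <=
    c + alpha * fine ('E_P[deductible c%:E \o Y])%E.
Proof.
move=> a1 gE EY; have a0 : 0 < alpha by lra.
have [q [fH _ _]] := distortion_risk_attained a1 gE EY.
have := distortion_risk_le a0 gE Y c.
by rewrite -(fineK fH) -(fineK (excess_fin_num c EY)) lee_fin.
Qed.

(** * Weighted sums of preferences *)

Lemma fin_num_pmulEl (R : realType) (a : R) (x : \bar R) : 0 < a ->
  (a%:E * x)%E \is a fin_num -> x \is a fin_num.
Proof.
move=> a0; case: x => [r| |]//; first by rewrite gt0_muley ?lte_fin.
by rewrite gt0_muleNy ?lte_fin.
Qed.

Lemma deductible0_id (R : realType) (c : \bar R) (x : R) :
  deductible 0%:E (deductible c x) = deductible c x.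
Proof.
by case: c => [r| |]; rewrite /deductible subr0 max_l// le_max lexx orbT.
Qed.

Lemma deductible_retained (R : realType) (q x : R) :
  deductible q%:E (x - deductible q%:E x) = 0.
Proof. by rewrite /deductible max_r// addrAC subr_le0 le_max lexx. Qed.

Lemma weighted_sum_pareto d (T : measurableType d) (R : realType)
    (P : probability T R) (V1 V2 : {RV P >-> R} -> \bar R)
    (X Y1 Y2 : {RV P >-> R}) (l1 l2 : R) : 0 < l1 -> 0 < l2 ->
  allocation V1 V2 X Y1 Y2 ->
  (forall Z1 Z2, allocation V1 V2 X Z1 Z2 ->
    l1 * fine (V1 Y1) + l2 * fine (V2 Y2) <=
    l1 * fine (V1 Z1) + l2 * fine (V2 Z2)) ->
  pareto_optimal V1 V2 X Y1 Y2.
Proof.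
move=> l10 l20 aY minY; split => // Z1 Z2 aZ.
have [_ f1 f2] := aY; have [_ fZ1 fZ2] := aZ.
have := minY _ _ aZ.
rewrite -(fineK f1) -(fineK f2) -(fineK fZ1) -(fineK fZ2) !lee_fin/= => le.
move=> /(ler_wpM2l (ltW l10)) le1 /(ler_wpM2l (ltW l20)) le2.
split; congr EFin.
  by apply: (mulfI (lt0r_neq0 l10)); lra.
by apply: (mulfI (lt0r_neq0 l20)); lra.
Qed.

Section finite_preferences.
Context d (T : measurableType d) (R : realType) (P : probability T R).
Variables (g : R -> R) (b theta : R) (Y : {RV P >-> R}).
Hypothesis theta_ge0 : 0 <= theta.

Lemma insurer_pref_fin_expectation :
  insurer_pref g b theta Y \is a fin_num -> ('E_P[Y])%E \is a fin_num.
Proof.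
have t0 : 0 < 1 + theta by rewrite ltr_pwDl.
by rewrite /insurer_pref fin_numB => /andP[_ /(fin_num_pmulEl t0)].
Qed.

Lemma buyer_pref_fin_expectation :
  buyer_pref g theta Y \is a fin_num -> ('E_P[Y])%E \is a fin_num.
Proof.
have t0 : 0 < 1 + theta by rewrite ltr_pwDl.
by rewrite /buyer_pref fin_numB => /andP[_ /(fin_num_pmulEl t0)].
Qed.

End finite_preferences.

Section deductible_insurance.
Context d (T : measurableType d) (R : realType) (P : probability T R).
Variables (g1 g2 : R -> R) (b1 theta alpha1 alpha2 : R).
Hypotheses (b1_gt0 : 0 < b1) (b1_lt_theta : b1 < theta)
  (alpha1_gt1 : 1 < alpha1) (alpha1_lt_alpha2 : alpha1 < alpha2)
  (g1E : {in `[0, 1], forall p, g1 p = Num.min (alpha1 * p) 1})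
  (g2E : {in `[0, 1], forall p, g2 p = Num.min (alpha2 * p) 1}).

Implicit Type Y : {RV P >-> R}.
Local Notation V1 := (insurer_pref g1 b1 theta : {RV P >-> R} -> \bar R).
Local Notation V2 := (buyer_pref g2 theta : {RV P >-> R} -> \bar R).

(** [gamma] is the factor that the expected excess of the insurer's share over
its quantile gets in the weighted sum divided by [theta - b1]; it competes with
the buyer's [alpha2]. *)
Variable gamma : R.
Hypothesis gammaE : (theta - b1) * gamma =
  theta * (1 + b1) * alpha1 - (1 + theta) * b1.

Let theta_ge0 : 0 <= theta.
Proof. exact: ltW (lt_trans b1_gt0 b1_lt_theta). Qed.

Let alpha2_gt1 : 1 < alpha2.
Proof. exact: lt_trans alpha1_gt1 alpha1_lt_alpha2. Qed.

Lemma gamma_gt1 : 1 < gamma.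
Proof.
have [b0 bt a1] := And3 b1_gt0 b1_lt_theta alpha1_gt1.
have lam0 : 0 < theta - b1 by lra.
rewrite -(ltr_pM2l lam0) mulr1 gammaE.
suff : 0 < theta * (1 + b1) * (alpha1 - 1) by lra.
by rewrite !mulr_gt0//; lra.
Qed.

Lemma insurer_pref_fine Y : ('E_P[Y])%E \is a fin_num ->
  V1 Y = ((1 + b1) * fine (distortion_risk g1 Y) -
    (1 + theta) * fine ('E_P[Y])%E)%:E.
Proof.
move=> EY; have [q [H1 _ _]] := distortion_risk_attained alpha1_gt1 g1E EY.
by rewrite EFinB !EFinM !fineK.
Qed.

Lemma buyer_pref_fine Y : ('E_P[Y])%E \is a fin_num ->
  V2 Y = (fine (distortion_risk g2 Y) -
    (1 + theta) * fine ('E_P[Y])%E)%:E.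
Proof.
move=> EY.
have [q [H2 _ _]] := distortion_risk_attained alpha2_gt1 g2E EY.
by rewrite EFinB EFinM !fineK.
Qed.

(** Write both risks at their quantiles q1 and q2.  The premium term of the
insurer is absorbed by E Z1 <= q1 + E(Z1 - q1)_+, which turns the factor
[theta * (1 + b1) * alpha1] of E(Z1 - q1)_+ into [(theta - b1) * gamma]; the two
excesses then dominate that of X over q1 + q2. *)
Lemma weighted_pref_ge (X Z1 Z2 : {RV P >-> R}) : allocation V1 V2 X Z1 Z2 ->
  exists c, (theta - b1) *
      (c + Num.min gamma alpha2 * fine ('E_P[deductible c%:E \o X])%E) -
      (theta - b1) * (1 + theta) * fine ('E_P[X])%E <=
    theta * fine (V1 Z1) + (theta - b1) * fine (V2 Z2).
Proof.
case=> sumX fV1 fV2.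
have E1 : ('E_P[Z1])%E \is a fin_num
  by exact: insurer_pref_fin_expectation theta_ge0 fV1.
have E2 : ('E_P[Z2])%E \is a fin_num
  by exact: buyer_pref_fin_expectation theta_ge0 fV2.
have EXE := ae_expectationD sumX E1 E2.
have EX : ('E_P[X])%E \is a fin_num by rewrite EXE fin_numD E1.
rewrite insurer_pref_fine// buyer_pref_fine//=.
have [q1 [_ fe1 ->]] := distortion_risk_attained alpha1_gt1 g1E E1.
have [q2 [_ fe2 ->]] :=
  distortion_risk_attained alpha2_gt1 g2E E2.
exists (q1 + q2).
have := excess_ge q1 E1; have := excess_subadditive q1 q2 sumX.
have fe := excess_fin_num (q1 + q2) EX.
have ge0 Z c : 0 <= fine ('E_P[deductible c%:E \o Z])%E.
  by rewrite fine_ge0// expectation_ge0// => w; rewrite le_max lexx orbT.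
move: (ge0 Z1 q1) (ge0 Z2 q2).
rewrite EXE (fineD E1 E2) -(fineK fe1) -(fineK fe2) -(fineK fe) -(fineK E1).
rewrite -EFinD -EFinB !lee_fin/=.
move: (fine _) (fine _) (fine _) (fine _) (fine _) => m2 m1 e x2 x1.
move=> x1_ge0 x2_ge0 e_le m1_le.
have [[b0 bt] [a1 a12] [gE gamma1]] := And3 (conj b1_gt0 b1_lt_theta)
  (conj alpha1_gt1 alpha1_lt_alpha2) (conj gammaE gamma_gt1).
have : Num.min gamma alpha2 <= gamma by rewrite ge_min lexx.
have : Num.min gamma alpha2 <= alpha2 by rewrite ge_min lexx orbT.
have : 0 <= Num.min gamma alpha2 by rewrite le_min; apply/andP; split; lra.
move: (Num.min _ _) => b b_ge0 b_le2 b_leg.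
have lam0 : 0 <= theta - b1 by lra.
(* b is the smaller of gamma and alpha2, e the expected excess of X, x1 and x2
   those of the two shares, m1 the mean of Z1. *)
have s1 : (theta - b1) * b * e <= (theta - b1) * b * (x1 + x2).
  by rewrite ler_wpM2l// mulr_ge0.
have s2 : (theta - b1) * b * x1 <= (theta - b1) * gamma * x1.
  by rewrite ler_wpM2r// ler_wpM2l.
have s3 : (theta - b1) * b * x2 <= (theta - b1) * alpha2 * x2.
  by rewrite ler_wpM2r// ler_wpM2l.
have s4 : (1 + theta) * b1 * (m1 - q1) <= (1 + theta) * b1 * x1.
  by rewrite ler_wpM2l// mulr_ge0//; lra.
rewrite gE in s2.
lra.
Qed.

Lemma deductible_allocation (X : {RV P >-> R}) (c : \bar R) :
  ('E_P[X])%E \is a fin_num ->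
  let f : {RV P >-> R} := deductible c \o X in
  allocation V1 V2 X f (X \- f).
Proof.
move=> EX f.
have sumX : {ae P, forall w, f w + (X \- f) w = X w}.
  by apply: aeW => w; rewrite /= addrC subrK.
have Ef : ('E_P[f])%E \is a fin_num.
  suff Ed b : ('E_P[deductible b \o X])%E \is a fin_num by exact: Ed.
  case: b => [b| |]; first exact: excess_fin_num.
    by rewrite (_ : _ \o _ = cst 0)// expectation_cst.
  by rewrite (_ : _ \o _ = cst 0)// expectation_cst.
have Er : ('E_P[X \- f])%E \is a fin_num.
  have /expectation_fin_numP iX := EX; have /expectation_fin_numP iF := Ef.
  apply/(expectation_fin_numP (X \- f)).
  exact: (integrableB measurableT iX iF).
by split => //; rewrite ?insurer_pref_fine ?buyer_pref_fine.
Qed.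

(** The left-hand side is theta V1 + (theta - b1) V2 without the multiple of
E X that all allocations share. *)
Lemma pareto_of_weighted_bound (X Y1 Y2 : {RV P >-> R}) :
  allocation V1 V2 X Y1 Y2 ->
  (forall c : R,
    theta * (1 + b1) * fine (distortion_risk g1 Y1) -
    (1 + theta) * b1 * fine ('E_P[Y1])%E +
    (theta - b1) * fine (distortion_risk g2 Y2) <=
    (theta - b1) *
      (c + Num.min gamma alpha2 * fine ('E_P[deductible c%:E \o X])%E)) ->
  pareto_optimal V1 V2 X Y1 Y2.
Proof.
move=> allocY bnd.
have [b0 bt] := conj b1_gt0 b1_lt_theta.
apply: (@weighted_sum_pareto _ _ _ _ _ _ _ _ _ theta (theta - b1)) => //;
  [lra|lra|].
move=> Z1 Z2 /weighted_pref_ge[c]; apply: le_trans.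
have [sumX fV1 fV2] := allocY.
have E1 : ('E_P[Y1])%E \is a fin_num
  by exact: insurer_pref_fin_expectation theta_ge0 fV1.
have E2 : ('E_P[Y2])%E \is a fin_num
  by exact: buyer_pref_fin_expectation theta_ge0 fV2.
rewrite insurer_pref_fine// buyer_pref_fine//= (ae_expectationD sumX E1 E2).
by rewrite (fineD E1 E2); have := bnd c; lra.
Qed.

(** With no insurance only the buyer's risk of X contributes to the bound, and
it is below c + alpha2 E(X - c)_+ for every c. *)
Lemma full_retention_pareto (X : {RV P >-> R}) :
  ('E_P[X])%E \is a fin_num -> alpha2 <= gamma ->
  let f : {RV P >-> R} := deductible +oo \o X in
  pareto_optimal V1 V2 X f (X \- f).
Proof.
move=> EX alpha2_le f.
have allocf : allocation V1 V2 X f (X \- f) := deductible_allocation +oo EX.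
apply: (pareto_of_weighted_bound allocf) => c.
have [_ fV1 fV2] := allocf.
have Ef := insurer_pref_fin_expectation theta_ge0 fV1.
have Er := buyer_pref_fin_expectation theta_ge0 fV2.
have := fine_distortion_risk_le 0 alpha1_gt1 g1E Ef.
have := fine_distortion_risk_le c alpha2_gt1 g2E Er.
have -> : ('E_P[deductible c%:E \o (X \- f)%R] =
    'E_P[deductible c%:E \o X])%E.
  by congr expectation; apply/funext => w; rewrite /= /deductible subr0.
have -> : ('E_P[deductible 0%:E \o f] = 0)%E.
  rewrite -[RHS](expectation_cst P 0); congr expectation.
  by apply/funext => w; exact: (deductible0_id +oo).
have -> : ('E_P[f] = 0)%E by rewrite -[RHS](expectation_cst P 0).
rewrite min_r//= !mulr0 !addr0 subr0.
move: (fine _) (fine _) (fine _) => h1 ec h2 h2_le h1_le.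
have [b0 bt] := conj b1_gt0 b1_lt_theta.
have lam_ge0 : 0 <= theta - b1 by lra.
have s1 : theta * (1 + b1) * h1 <= theta * (1 + b1) * 0.
  by rewrite ler_wpM2l// mulr_ge0//; lra.
have := ler_wpM2l lam_ge0 h2_le; lra.
Qed.

(** The cuts 0 for the insurer and [q] for the buyer bound the two risks by
alpha1 E(X - q)_+ and by q, since the buyer never loses more than q.  The
weighted sum is then at most (theta - b1) (q + gamma E(X - q)_+), and no cut
other than q makes this smaller because q is a quantile. *)
Lemma quantile_deductible_pareto (X : {RV P >-> R}) (q : R) :
  ('E_P[X])%E \is a fin_num -> gamma <= alpha2 ->
  is_tail_quantile X gamma^-1 q ->
  let f : {RV P >-> R} := deductible q%:E \o X in
  pareto_optimal V1 V2 X f (X \- f).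
Proof.
move=> EX gamma_le tq f.
have allocf : allocation V1 V2 X f (X \- f) := deductible_allocation q%:E EX.
apply: (pareto_of_weighted_bound allocf) => c.
have [_ fV1 fV2] := allocf.
have Ef := insurer_pref_fin_expectation theta_ge0 fV1.
have Er := buyer_pref_fin_expectation theta_ge0 fV2.
have := fine_distortion_risk_le 0 alpha1_gt1 g1E Ef.
have := fine_distortion_risk_le q alpha2_gt1 g2E Er.
have -> : ('E_P[deductible 0%:E \o f] = 'E_P[f])%E.
  by congr expectation; apply/funext => w; exact: deductible0_id.
have -> : ('E_P[deductible q%:E \o (X \- f)%R] = 0)%E.
  rewrite -[RHS](expectation_cst P 0); congr expectation.
  by apply/funext => w; exact: deductible_retained.
have := tail_quantile_minimizes c (lt_trans ltr01 gamma_gt1) tq.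
rewrite -(fineK Ef) -(fineK (excess_fin_num c EX)) lee_fin/= min_l//.
rewrite mulr0 addr0 add0r.
move: (fine _) (fine _) (fine _) (fine _) => h1 h2 ec e q_le h2_le h1_le.
have [[b0 bt] gE] := conj (conj b1_gt0 b1_lt_theta) gammaE.
have lam_ge0 : 0 <= theta - b1 by lra.
have s1 : theta * (1 + b1) * h1 <= theta * (1 + b1) * (alpha1 * e).
  by rewrite ler_wpM2l// mulr_ge0//; lra.
have s2 : (theta - b1) * h2 <= (theta - b1) * q by rewrite ler_wpM2l.
have s3 := ler_wpM2l lam_ge0 q_le.
have s4 : (theta - b1) * gamma * e =
    (theta * (1 + b1) * alpha1 - (1 + theta) * b1) * e by rewrite gE.
lra.
Qed.

End deductible_insurance.

Theorem corollary2 (d : measure_display) (T : measurableType d) (R : realType)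
    (P : probability T R) (X : {RV P >-> R}) (g1 g2 : R -> R)
    (b1 theta alpha1 alpha2 : R)
    (X_ge0 : {ae P, forall w, 0 <= X w})
    (g1_distortion : concave_distortion g1)
    (g2_distortion : concave_distortion g2)
    (HX_fin : distortion_risk g2 X \is a fin_num)
    (b1_gt0 : 0 < b1) (b1_lt_theta : b1 < theta)
    (alpha1_gt1 : 1 < alpha1) (alpha1_lt_alpha2 : alpha1 < alpha2)
    (g1E : {in `[0, 1], forall p, g1 p = Num.min (alpha1 * p) 1})
    (g2E : {in `[0, 1], forall p, g2 p = Num.min (alpha2 * p) 1}) :
  deductible_optimal (insurer_pref g1 b1 theta) (buyer_pref g2 theta) X.
Proof.
have alpha2_gt0 : 0 < alpha2 by lra.
have alpha2_gt1 : 1 < alpha2 by lra.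
have lam_gt0 : 0 < theta - b1 by lra.
pose gamma := (theta * (1 + b1) * alpha1 - (1 + theta) * b1) / (theta - b1).
have gammaE : (theta - b1) * gamma =
    theta * (1 + b1) * alpha1 - (1 + theta) * b1.
  by rewrite mulrC mulfVK// gt_eqF.
have gamma_gt1 : 1 < gamma := gamma_gt1 b1_gt0 b1_lt_theta alpha1_gt1 gammaE.
clearbody gamma.
(* X coincides almost surely with its excess over 0. *)
have EX : ('E_P[X])%E \is a fin_num.
  have := distortion_risk_fin_excess alpha2_gt0 g2E (ltW alpha2_gt1) HX_fin.
  rewrite !expectation.unlock; congr (_ \is a fin_num).
  apply: ae_eq_integral => //; [| exact/measurable_EFinP|].
    by apply/measurable_EFinP; exact: (measurable_funPT (deductible 0%:E \o X)).
  by apply: filterS X_ge0 => w Xw _; rewrite /= /deductible subr0 max_l.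
have [gamma_le|/ltW alpha2_le] := leP gamma alpha2; last first.
  exists +oo%E; first exact: leey.
  exact: (full_retention_pareto b1_gt0 b1_lt_theta alpha1_gt1
    alpha1_lt_alpha2 g1E g2E gammaE EX alpha2_le).
have gamma_gt0 := lt_trans ltr01 gamma_gt1.
have gammaV_lt1 : gamma^-1 < 1 by rewrite invf_lt1.
have [|q tq] := @tail_quantile_exists _ _ _ P X gamma^-1.
  by rewrite invr_gt0 gamma_gt0.
exists q%:E; first by rewrite lee_fin (tail_quantile_ge0 gammaV_lt1 tq).
exact: (quantile_deductible_pareto b1_gt0 b1_lt_theta alpha1_gt1
  alpha1_lt_alpha2 g1E g2E gammaE EX gamma_le tq).
Qed.
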